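(* For every $c_0 > 0$ and $\delta > 0$ there exists $C = C(\delta, c_0) > 0$ such that the following holds. Let $k, \ell \in \mathbb{N}$ with $\ell^3 \geqslant Ck$, and let $c \geqslant c_0$. Then the number of sets $S \subset \mathbb{N}$ with $|S| = \ell$, $\sum_{a \in S} a = k$ and $|S + S| \leqslant ck/\ell$ is at most $$2^{\delta \ell} \left( \frac{2cek}{3\ell^2} \right)^{\ell}.$$
   Context: $\mathbb{N} = \{1,2,3,\ldots\}$. For $A, B \subset \mathbb{N}$, the sumset is $A + B = \{a + b : a \in A, b \in B\}$. *)

(* Defs.v *)
From mathcomp Require Import all_boot all_order all_algebra.
From mathcomp Require Import all_classical all_reals all_analysis.
Set Implicit Arguments. Unset Strict Implicit. Unset Printing Implicit Defensive.
Import Order.TTheory GRing.Theory Num.Theory.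

Definition sumset_card (n : nat) (S : {set 'I_n}) : nat :=
  size (undup [seq (val a + val b)%N | a <- enum S, b <- enum S]).

Local Open Scope ring_scope.

(* The sets S of positive integers with |S| = l, sum_{a in S} a = k and
   |S + S| <= c k / l.  Any such S is contained in {1,...,k}, so encoding it
   as a subset of 'I_k.+1 not containing 0 loses nothing. *)
Definition good_sets (R : realType) (k l : nat) (c : R) : {set {set 'I_k.+1}} :=
  [set S : {set 'I_k.+1} |
     [&& (ord0 \notin S), (#|S| == l)%N,
         ((\sum_(a in S) (val a))%N == k)
       & ((sumset_card S)%:R <= c * k%:R / l%:R)]].

(* Main.v *)
Require Import Defs.
From mathcomp Require Import all_boot.
From mathcomp Require Import zify.

(* Let D be a small multiple of l, and let L and U consist of the 8D smallest and
   the 8D largest elements of S.  Adding elements of S to L :|: U greedily as long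
   as each creates more than D new sums gives a fingerprint W of size at most 17D,
   because |S + S| <= c k / l <= D^2.  All of S outside W then lies in the set A of
   those v between L and U such that v + (L :|: U) has at most D elements outside
   W + W.  By averaging there are f in L and g in U such that f + A and g + A lie
   mostly in W + W; these translates are disjoint, hence 7 |A| <= 4 |S + S|.  Thus
   S is determined by the triple (W, L, U), which has few possible values since the
   sum of W is at most k, and by a subset of A.  As 4/7 < 2/3, the exponential gain
   from A pays for the choice of (W, L, U) without the factor 2^(delta l).  For
   c >= 3e the bound already holds for all l-sets of sum k. *)

(** * Sumsets as finite sets *)

Lemma ltn_addn_ord n (a b : 'I_n) : a + b < n + n.
Proof. by rewrite -addnS leq_add // ltnW. Qed.

(** Values live in ['I_(n + n)], so that no sum overflows and a sumset is a finite set. *)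
Definition addo n (a b : 'I_n) : 'I_(n + n) := Ordinal (ltn_addn_ord n a b).

Lemma addo_inj n (a : 'I_n) : injective (addo n a).
Proof. by move=> x y /(congr1 val) /= /addnI /val_inj. Qed.

Definition sumset n (S : {set 'I_n}) := addo n @2: (S, S).

Lemma sumset_cardE n (S : {set 'I_n}) : sumset_card S = #|sumset n S|.
Proof.
rewrite cardE -(size_map val); apply/perm_size/uniq_perm.
- exact: undup_uniq.
- by rewrite (map_inj_uniq val_inj) enum_uniq.
move=> z; rewrite mem_undup.
apply/allpairsP/mapP => [[[a b] /= [aS bS ->]]|[w]].
  exists (addo n a b) => //; rewrite mem_enum in aS; rewrite mem_enum in bS.
  by rewrite mem_enum; apply/imset2P; exists a b.
rewrite mem_enum => /imset2P [a b aS bS ->] ->.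
by exists (a, b); rewrite /= !mem_enum.
Qed.

Lemma sumsetS n (S T : {set 'I_n}) : S \subset T -> sumset n S \subset sumset n T.
Proof. by move=> sST; apply: imset2S. Qed.

(** * Extremal parts and saturated subsets *)

(** Greedy: keep adding a minimiser of [f] among the elements left. The weight [f] will be the value
    (smallest elements), the reversed value (largest ones) or a constant (any subset of given
    size). *)
Lemma initial_part (T : finType) (f : T -> nat) (S : {set T}) s : s <= #|S| ->
  exists L : {set T}, [/\ L \subset S, #|L| = s &
    {in L & S :\: L, forall x y, f x <= f y}].
Proof.
elim: s => [|s IHs] sS.
  by exists set0; split=> [||x y]; rewrite ?sub0set ?cards0 ?in_set0.
have [L [LS Ls Lf]] := IHs (ltnW sS).
have /card_gt0P [z0 z0SL] : 0 < #|S :\: L| by rewrite cardsDS // Ls subn_gt0.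
case: (arg_minnP f z0SL) => z zSL zmin; have /setDP [zS zL] : z \in S :\: L := zSL.
exists (z |: L); split; first by rewrite subUset sub1set zS.
  by rewrite cardsU1 zL Ls.
move=> x y; rewrite !inE negb_or => /predU1P [-> | xL] /andP [/andP [_ yL] yS].
  by apply: zmin; apply/setDP.
by apply: Lf; rewrite // inE yL.
Qed.

(* A maximiser W of |W + W| - D |W|: adding one more element of S to W creates
   at most D new sums. *)
Lemma saturated_subset n (S F : {set 'I_n}) D : F \subset S ->
  exists W : {set 'I_n}, [/\ F \subset W, W \subset S,
    D * (#|W| - #|F|) <= #|sumset n S| &
    {in S :\: W, forall v, #|(addo n v @: F) :\: sumset n W| <= D}].
Proof.
move=> FS.
pose P (W : {set 'I_n}) := (F \subset W) && (W \subset S).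
(* Up to the constant [D * #|S|] this is |W + W| - D |W|, kept within the naturals. *)
pose g (W : {set 'I_n}) := #|sumset n W| + D * (#|S| - #|W|).
have PF : P F by rewrite /P subxx.
case: (arg_maxnP g PF) => W /andP [FW WS] Wmax; exists W; split=> //.
  (* Comparing [W] with [F] itself bounds [#|W| - #|F|]. *)
  have := Wmax _ PF; have := subset_leq_card (sumsetS _ _ _ WS).
  have := subset_leq_card FW; have := subset_leq_card WS; rewrite /g /=; nia.
move=> v; rewrite inE => /andP [vW vS].
have vWS : v |: W \subset S by rewrite subUset sub1set vS.
have PvW : P (v |: W) by rewrite /P vWS andbT (subset_trans FW) // subsetUr.
have := Wmax _ PvW; have := subset_leq_card vWS; rewrite /g /= cardsU1 vW add1n.
move=> WS1; rewrite -(subnSK WS1) mulnS /geq /=.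
(* The sums [v + f] with [f] in [F] are sums of [v |: W] because [F \subset W]. *)
have : #|sumset n W| + #|(addo n v @: F) :\: sumset n W| <= #|sumset n (v |: W)|.
  have disj (X : {set 'I_(n + n)}) : sumset n W :&: (X :\: sumset n W) = set0.
    by rewrite setIDA setIC -setIDA setDv setI0.
  rewrite -cardsUI disj cards0 addn0 subset_leq_card // subUset sumsetS ?subsetUr //=.
  apply: subset_trans (subsetDl _ _) _; apply/subsetP => z /imsetP [f fF ->].
  by apply/imset2P; exists v f => //; rewrite !inE ?eqxx // (subsetP FW) // orbT.
move=> new_sums; rewrite addnA leq_add2r => Wge.
by rewrite -(leq_add2l #|sumset n W|) (leq_trans new_sums).
Qed.

Lemma subset_between (T : finType) (A B : {set T}) j :
  A \subset B -> #|A| <= j <= #|B| ->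
  exists C : {set T}, [/\ A \subset C, C \subset B & #|C| = j].
Proof.
move=> AB /andP [Aj jB].
have [|L [LBA Ls _]] := @initial_part T (fun=> 0) (B :\: A) (j - #|A|).
  by rewrite cardsDS // leq_sub2r.
exists (A :|: L); rewrite subsetUl subUset AB (subset_trans LBA) ?subsetDl //; split=> //.
have disj : [disjoint A & L].
  rewrite disjoint_sym; apply: disjointWl LBA _.
  by rewrite -setI_eq0 setIC setIDA setIC -setIDA setDv setI0.
rewrite cardsU Ls (eqP (_ : A :&: L == set0)) ?setI_eq0 // cards0 subn0 subnKC //.
Qed.

(** * Translates and containers *)

Lemma addoC n (a b : 'I_n) : addo n a b = addo n b a.
Proof. by apply: val_inj; rewrite /= addnC. Qed.

Lemma card_missing_sums n (v : 'I_n) (A : {set 'I_n}) (B : {set 'I_(n + n)}) :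
  #|(addo n v @: A) :\: B| = \sum_(a in A) (addo n v a \notin B).
Proof.
have -> : (addo n v @: A) :\: B = addo n v @: [set a in A | addo n v a \notin B].
  apply/setP => z; apply/setDP/imsetP => [[/imsetP [a aA ->] aB]|[a]].
    by exists a => //; rewrite inE aA.
  by rewrite inE => /andP [aA aB] ->; rewrite imset_f.
rewrite card_imset; last exact: addo_inj.
by rewrite -sum1_card big_mkcond [RHS]big_mkcond; apply: eq_bigr => a _; rewrite inE; case: (a \in A); case: (_ \notin _).
Qed.

(** Double counting: at most [D * #|A|] pairs of [L] times [A] have their sum outside [B], and the
    best [f] does no worse than the average. *)
Lemma good_translate n (L A : {set 'I_n}) (B : {set 'I_(n + n)}) D :
  0 < #|L| -> {in A, forall v, #|(addo n v @: L) :\: B| <= D} ->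
  exists2 f, f \in L & #|L| * #|(addo n f @: A) :\: B| <= D * #|A|.
Proof.
move=> /card_gt0P [f0 f0L] LAB.
case: (arg_minnP (fun f => #|(addo n f @: A) :\: B|) f0L) => f fL fmin.
exists f => //; rewrite -sum_nat_const.
apply: (@leq_trans (\sum_(g in L) #|(addo n g @: A) :\: B|)).
  by apply: leq_sum => g gL; apply: fmin.
rewrite mulnC -sum_nat_const (eq_bigr _ (fun g _ => card_missing_sums _ g A B)).
rewrite exchange_big /=; apply: leq_sum => v vA; apply: leq_trans (LAB v vA).
by rewrite card_missing_sums; apply/eq_leq/eq_bigr => g _; rewrite addoC.
Qed.

(** Built from [L], [U], [B] and [D] alone, so that one container serves every [S] with the same
    fingerprint data. *)
Definition container n (L U : {set 'I_n}) (B : {set 'I_(n + n)}) D :=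
  [set v : 'I_n | [&& [forall x in L, x < v], [forall x in U, v < x] &
                      #|(addo n v @: (L :|: U)) :\: B| <= D]].

(* As A lies between L and U, the translates f + A and f' + A with f in L and
   f' in U are disjoint, and on average they lie almost entirely in B. *)
Lemma card_container n (L U : {set 'I_n}) (B : {set 'I_(n + n)}) D s :
  0 < s -> #|L| = s -> #|U| = s ->
  2 * (s * #|container n L U B D|) <= s * #|B| + 2 * (D * #|container n L U B D|).
Proof.
move=> s0 Ls Us; set A := container n L U B D.
have AD (X : {set 'I_n}) : X \subset L :|: U -> {in A, forall v, #|(addo n v @: X) :\: B| <= D}.
  move=> XLU v; rewrite inE => /and3P [_ _]; apply: leq_trans.
  exact/subset_leq_card/setSD/imsetS.
have [||f fL fA] := @good_translate n L A B D; [by rewrite Ls | exact/AD/subsetUl |].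
have [||g gU gA] := @good_translate n U A B D; [by rewrite Us | exact/AD/subsetUr |].
(* A coincidence [f + v = g + w] contradicts [f < w] and [v < g]. *)
have disj : [disjoint addo n f @: A & addo n g @: A].
  rewrite -setI_eq0; apply/eqP/setP => z; rewrite !inE; apply/negP.
  case/andP => /imsetP [v + ->] /imsetP [w + /(congr1 val) /= /eqP].
  rewrite !inE => /and3P [_ /forall_inP vU _] /and3P [/forall_inP Lw _ _].
  by have := vU g gU; have := Lw f fL; lia.
have : #|(addo n f @: A) :&: B| + #|(addo n g @: A) :&: B| <= #|B|.
  have /leqifP := leq_card_setU ((addo n f @: A) :&: B) ((addo n g @: A) :&: B).
  rewrite (disjointWl (subsetIl _ _)) ?(disjointWr (subsetIl _ _)) // => /eqP <-.
  by rewrite subset_leq_card // -setIUl subsetIr.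
have split_by_B x : #|A| = #|(addo n x @: A) :&: B| + #|(addo n x @: A) :\: B|.
  by rewrite cardsID card_imset //; exact: addo_inj.
rewrite Ls in fA; rewrite Us in gA.
have := split_by_B f; have := split_by_B g; move: fA gA.
move: #|A| #|_ :\: _| #|_ :\: _| #|_ :&: _| #|_ :&: _| #|B| => a x y u v b.
nia.
Qed.

(** * Counting sets through fingerprints *)

Lemma card_bigcup_le (I T : finType) (P : {pred I}) (F : I -> {set T}) b :
  {in P, forall i, #|F i| <= b} -> #|\bigcup_(i in P) F i| <= #|P| * b.
Proof.
move=> Fb; rewrite -sum_nat_const.
elim/big_ind2: _ => [|A x B y Ax By|i /Fb //]; first by rewrite cards0.
by rewrite (leq_trans _ (leq_add Ax By)) // leq_card_setU.
Qed.

(** Each [W] has [j!] orderings, each a [j]-tuple of sum at most [k]. A tuple determines its [W],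
    and there are ['C(j + k, j)] such tuples. *)
Lemma card_sets_of_small_sum k j :
  #|[set W : {set 'I_k.+1} | (#|W| == j) && (\sum_(a in W) val a <= k)]| * j`!
    <= 'C(j + k, j).
Proof.
rewrite -card_partial_ord_partitions -sum_nat_const.
pose orderings (W : {set 'I_k.+1}) (t : j.-tuple 'I_k.+1) := all (mem W) t && uniq t.
have orderingE (W : {set 'I_k.+1}) t : #|W| = j -> orderings W t -> W = [set x in t].
  move=> Wj /andP [/allP tW t_uniq]; apply/esym/eqP; rewrite eqEcard; apply/andP; split.
    by apply/subsetP => x; rewrite inE => /tW.
  by rewrite Wj cardsE (card_uniqP t_uniq) size_tuple.
rewrite (eq_bigr (fun W => \sum_(t | orderings W t) 1)); last first.
  move=> W; rewrite inE => /andP [/eqP Wj _].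
  by rewrite sum1dep_card card_uniq_tuples Wj ffactnn.
rewrite (exchange_big_dep (fun t : j.-tuple 'I_k.+1 => \sum_(i <- t) i <= k)) /=; last first.
  move=> W t; rewrite inE => /andP [/eqP Wj Wk] Wt.
  have /andP [_ t_uniq] := Wt; rewrite big_uniq // (leq_trans _ Wk) //.
  by rewrite [leqRHS](eq_bigl (mem t)) // => x; rewrite (orderingE W t Wj Wt) inE.
rewrite -[leqRHS]sum1dep_card; apply: leq_sum => t _; rewrite sum1dep_card.
rewrite -(cards1 [set x in t]) subset_leq_card //; apply/subsetP => W.
by rewrite !inE => /andP [/andP [/eqP Wj _] Wt]; rewrite (orderingE W t).
Qed.

(** Since [D * (#|W0| - 16 * D) <= m <= D * D], the saturated set [W0] has at most [17 * D]
    elements; it is padded inside [S] to exactly that size. *)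
Lemma container_cover n (S : {set 'I_n}) D m : 0 < D -> 17 * D <= #|S| ->
  #|sumset n S| <= m -> m <= D * D ->
  exists W L U : {set 'I_n}, [/\ W \subset S, #|W| = 17 * D,
    [/\ L \subset W & #|L| = 8 * D], [/\ U \subset W & #|U| = 8 * D] &
    S :\: W \subset container n L U (sumset n W) D].
Proof.
move=> D0 DS Sm mD.
have [|L [LS Ls Lle]] := @initial_part _ val S (8 * D).
  by apply: leq_trans DS; rewrite leq_mul2r orbT.
have DDS : 8 * D + 8 * D <= #|S| by apply: leq_trans DS; lia.
(* The weight [n - val x] reverses the order, as [val x < n], so this picks the largest elements;
   taking them outside [L] makes [U] disjoint from [L]. *)
have [|U [USL Us Ule]] := @initial_part _ (fun x => n - val x) (S :\: L) (8 * D).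
  by rewrite cardsDS // Ls -[leqLHS](addnK (8 * D)) leq_sub2r.
have /subsetDP [US UL] := USL.
have FS : L :|: U \subset S by rewrite subUset LS.
have cF : #|L :|: U| = 16 * D.
  rewrite cardsU Ls Us (eqP (_ : L :&: U == set0)) ?cards0; last first.
    by rewrite setI_eq0 disjoint_sym.
  lia.
have [W0 [FW0 W0S W0D W0sat]] := saturated_subset n S (L :|: U) D FS.
have [|W [W0W WS Wj]] := @subset_between _ W0 S (17 * D) W0S.
  rewrite DS andbT; have : D * (#|W0| - 16 * D) <= D * D.
    by rewrite -cF (leq_trans W0D) // (leq_trans Sm).
  rewrite leq_pmul2l //; lia.
have FW := subset_trans FW0 W0W.
exists W, L, U; split=> //.
- by split=> //; apply: subset_trans FW; apply: subsetUl.
- by split=> //; apply: subset_trans FW; apply: subsetUr.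
apply/subsetP => v /setDP [vS vW]; rewrite inE.
have vL : v \notin L by apply: contra vW => vL; rewrite (subsetP FW) // inE vL.
have vU : v \notin U by apply: contra vW => vU; rewrite (subsetP FW) // inE vU orbT.
apply/and3P; split.
- apply/forall_inP => x xL; rewrite ltn_neqAle Lle // ?inE ?vL // andbT.
  by apply: contraNneq vL => /val_inj <-.
- apply/forall_inP => x xU; rewrite ltn_neqAle; apply/andP; split.
    by apply: contraNneq vU => /val_inj ->.
  have /(_ x v xU) := Ule; rewrite !inE vU vL vS => /(_ isT).
  move=> nxv; rewrite leqNgt; apply/negP => xv.
  by have := ltn_sub2l (ltn_ord x) xv; rewrite ltnNge nxv.
have vW0 : v \in S :\: W0.
  by rewrite inE vS andbT; apply: contra vW; apply: (subsetP W0W).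
(* Padding [W0] to [W] only enlarges the sumset, so no further sum goes missing. *)
apply: leq_trans (W0sat v vW0); apply/subset_leq_card/setDS; exact: sumsetS.
Qed.

(** The two subsets [L] and [U] of [W] cost [4 ^ (17 * D)]; the other [l - 17 * D] elements of [S]
    come from a container of size at most [4 * m %/ 7]. *)
Lemma card_sets_of_small_sumset k l m D : 0 < D -> 17 * D <= l -> m <= D * D ->
  #|[set S : {set 'I_k.+1} | [&& #|S| == l, \sum_(a in S) val a <= k
                                & #|sumset _ S| <= m]]| * (17 * D)`!
    <= 'C(17 * D + k, 17 * D) * (4 ^ (17 * D) * 'C(4 * m %/ 7, l - 17 * D)).
Proof.
move=> D0 Dl mD; set j := 17 * D; set G := [set S | _].
pose P (W : {set 'I_k.+1}) := [set L in powerset W | #|L| == 8 * D].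
pose A (W L U : {set 'I_k.+1}) := container k.+1 L U (sumset _ W) D.
pose ext (W L U : {set 'I_k.+1}) :=
  [set W :|: X | X : {set 'I_k.+1} in [set X : {set 'I_k.+1} | (X \subset A W L U) && (#|X| == l - j)]].
pose Ws := [set W : {set 'I_k.+1} | [&& #|W| == j, \sum_(a in W) val a <= k
                                & #|sumset _ W| <= m]].
have GP : G \subset \bigcup_(W in Ws) \bigcup_(L in P W) \bigcup_(U in P W) ext W L U.
  apply/subsetP => S; rewrite inE => /and3P [/eqP Sl Sk Sm].
  have [|W [L [U [WS Wj [LW Ls] [UW Us] SW]]]] := container_cover _ S D m D0 _ Sm mD.
    by rewrite Sl.
  apply/bigcupP; exists W.
    rewrite inE Wj eqxx /= (leq_trans _ Sk) /=; last first.
      by rewrite [leqRHS](big_setID W) /= (setIidPr WS) leq_addr.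
    by rewrite (leq_trans _ Sm) // subset_leq_card // sumsetS.
  apply/bigcupP; exists L; first by rewrite inE powersetE LW Ls /=.
  apply/bigcupP; exists U; first by rewrite inE powersetE UW Us /=.
  apply/imsetP; exists (S :\: W); first by rewrite inE SW cardsDS // Sl Wj eqxx.
  by rewrite -[LHS](setID S W) (setIidPr WS).
have extb W : W \in Ws -> #|\bigcup_(L in P W) \bigcup_(U in P W) ext W L U|
     <= 4 ^ j * 'C(4 * m %/ 7, l - j).
  rewrite inE => /and3P [/eqP Wj _ Wm].
  have PW : #|P W| <= 2 ^ j.
    by rewrite -Wj -card_powerset subset_leq_card //; apply/subsetP => x; rewrite inE => /andP [].
  have extLU L U : L \in P W -> U \in P W -> #|ext W L U| <= 'C(4 * m %/ 7, l - j).
    rewrite !inE => /andP [_ /eqP Ls] /andP [_ /eqP Us].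
    apply: leq_trans (leq_imset_card _ _) _; rewrite cards_draws leq_bin2l //.
    have s0 : 0 < 8 * D by lia.
    (* For [s = 8 * D] this reads [16 D a <= 8 D b + 2 D a], that is, [7 a <= 4 b]. *)
    have := card_container _ L U (sumset _ W) D (8 * D) s0 Ls Us.
    rewrite -/(A W L U) leq_divRL //; move: Wm; move: #|A W L U| #|sumset _ W| => a b bm ab.
    suff : 7 * a <= 4 * b by lia.
    rewrite -(@leq_pmul2l (2 * D)); nia.
  have -> : 4 ^ j = 2 ^ j * 2 ^ j by rewrite -expnMn.
  rewrite -mulnA.
  apply: leq_trans (leq_mul PW (leqnn _)); apply: card_bigcup_le => L LP.
  apply: leq_trans (leq_mul PW (leqnn _)); apply: card_bigcup_le => U UP.
  exact: extLU.
apply: leq_trans (leq_mul (leq_trans (subset_leq_card GP) (card_bigcup_le _ _ _ _ _ extb)) (leqnn _)) _.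
rewrite mulnAC leq_mul2r; apply/orP; right.
apply: leq_trans (card_sets_of_small_sum k j).
rewrite leq_mul2r; apply/orP; right; apply: subset_leq_card; apply/subsetP => W.
by rewrite !inE => /and3P [-> ->].
Qed.

(* Factorials, binomials and geometric decay over the reals *)
From mathcomp Require Import all_boot all_order all_algebra.
From mathcomp Require Import all_classical all_reals all_analysis.
From mathcomp Require Import ring lra.
Import Order.TTheory GRing.Theory Num.Theory.
Local Open Scope ring_scope.

(** Induction on [r], using [(1 + 1/r)^r <= e]; the passage from 0 to 1 is separate, as this divides
    by [r]. *)
Lemma exprnn_le_fact (R : realType) r :
  r%:R ^+ r <= expR 1 ^+ r * r`!%:R :> R.
Proof.
elim: r => [|r IHr]; first by rewrite !expr0 mul1r.
case: r IHr => [|r] IHr.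
  by rewrite !expr1 mulr1 (le_trans _ (expR_ge1Dx 1)) // lerDr.
have r0 : 0 < r.+1%:R :> R by rewrite ltr0n.
have step : r.+2%:R ^+ r.+1 <= expR 1 * r.+1%:R ^+ r.+1 :> R.
  rewrite -ler_pdivrMr ?exprn_gt0 // -expr_div_n.
  have -> : expR 1 = expR (r.+1%:R^-1) ^+ r.+1 :> R.
    by rewrite -expRM_natl divff // gt_eqF.
  rewrite lerXn2r ?nnegrE ?divr_ge0 ?expR_ge0 ?ler0n //.
  by rewrite (le_trans _ (expR_ge1Dx _)) // -natr1 mulrDl divff ?gt_eqF // mul1r.
rewrite exprS factS natrM (exprS (expR 1)).
apply: le_trans (ler_wpM2l (ler0n _ _) (le_trans step (ler_wpM2l (expR_ge0 _) IHr))) _.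
by rewrite le_eqVlt; apply/orP; left; apply/eqP; ring.
Qed.

Lemma ffact_le_expn n r : (n ^_ r <= n ^ r)%N.
Proof.
by elim: r => // r IHr; rewrite ffactnSr expnSr leq_mul ?leq_subr.
Qed.

Lemma bin_mul_exprnn_le (R : realType) n r :
  'C(n, r)%:R * r%:R ^+ r <= (expR 1 * n%:R) ^+ r :> R.
Proof.
apply: le_trans (ler_wpM2l (ler0n _ _) (exprnn_le_fact R r)) _.
rewrite mulrCA exprMn ler_wpM2l ?exprn_ge0 ?expR_ge0 //.
by rewrite -natrM -natrX ler_nat bin_ffact ffact_le_expn.
Qed.

(** The constant 13 is self-reproducing: [13/14 * (13 + 1) = 13]. *)
Lemma natr_mul_geometric_le (R : realType) p :
  p%:R * (13 / 14) ^+ p <= 13 :> R.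
Proof.
elim: p => [|p IHp]; first by rewrite mul0r.
have : (13 / 14) ^+ p <= 1 :> R by apply: exprn_ile1; lra.
rewrite -(addn1 p) natrD exprD expr1; move: IHp; set u := _ ^+ p; set x := p%:R => xu u1.
have -> : (x + 1) * (u * (13 / 14)) = 13 / 14 * (x * u + u) by ring.
by move: xu u1; set y := x * u; lra.
Qed.

(** With [q = 4p + 1 <= 5p] and [u = (13/14)^p], the quantity is at most [25 K (p u)^4 / p^2], and
    [p u <= 13]. *)
Lemma square_mul_geometric_small (R : realType) (K : R) : 0 < K ->
  exists2 q, (13 <= q)%N & K * q%:R ^+ 2 * (13 / 14) ^+ q.-1 <= 1.
Proof.
move=> K0; pose M := 25 * 13 ^+ 4 * K.
(* This [p] is at least [M], and at least 3, whence [13 <= q]. *)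
pose p := ((Num.truncn M).+3)%N; exists (4 * p).+1; first by rewrite /p; lia.
have Mp : M <= p%:R.
  have := truncnS_gt M; rewrite /p -!natr1 => /ltW h; apply: le_trans h _.
  by rewrite -[leLHS]addr0 -!addrA; do 2 rewrite lerD2l; lra.
have p3 : 3 <= p%:R :> R by rewrite ler_nat.
rewrite /= mulnC exprM -natr1 natrM; set u := _ ^+ p.
have u0 : 0 <= u by rewrite exprn_ge0 //; lra.
have pu : p%:R * u <= 13 by apply: natr_mul_geometric_le.
have pu4 : (p%:R * u) ^+ 4 <= 13 ^+ 4.
  by rewrite lerXn2r ?nnegrE // mulr_ge0.
have p0 : 0 < p%:R ^+ 2 :> R by rewrite exprn_gt0 //; lra.
rewrite -(ler_pM2l p0) mulr1.
have pp : M <= p%:R ^+ 2 by rewrite (le_trans Mp) // expr2 ler_peMl //; lra.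
apply: le_trans pp; rewrite /M.
have q5 : (p%:R * 4 + 1) ^+ 2 <= (5 * p%:R) ^+ 2 :> R.
  by rewrite lerXn2r ?nnegrE //; lra.
apply: (@le_trans _ _ (25 * K * (p%:R * u) ^+ 4)); last first.
  by rewrite [leRHS]mulrAC ler_wpM2l // mulr_ge0 // ltW.
have -> : 25 * K * (p%:R * u) ^+ 4 = p%:R ^+ 2 * (K * (5 * p%:R) ^+ 2 * u ^+ 4) by ring.
rewrite ler_wpM2l ?(ltW p0) // ler_wpM2r ?exprn_ge0 // ler_wpM2l //.
exact: ltW.
Qed.

(** * Comparison with the target bound *)

(** The count is at most [(e^2 (l + k) / l^2)^l]; then [l + k <= 2k] and [3e <= c] suffice. *)
Lemma trivial_count_bound (R : realType) (c : R) (N k l : nat) :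
  (0 < l)%N -> (l <= k)%N -> 3 * expR 1 <= c ->
  (N * l`! <= 'C(l + k, l))%N ->
  N%:R <= (2 * c * expR 1 * k%:R / (3 * l%:R ^+ 2)) ^+ l.
Proof.
move=> l0 lk ec; rewrite -(ler_nat R) natrM => Nl.
have e0 : 0 < expR 1 :> R by apply: expR_gt0.
have e0' := ltW e0.
have l0' : 0 < l%:R :> R by rewrite ltr0n.
have lk' : l%:R <= k%:R :> R by rewrite ler_nat.
have count : N%:R * (l%:R ^+ l * l%:R ^+ l) <= (expR 1 * (expR 1 * (l + k)%:R)) ^+ l :> R.
  have ll0 : 0 <= l%:R ^+ l :> R by rewrite exprn_ge0.
  apply: (@le_trans _ _ (N%:R * (expR 1 ^+ l * l`!%:R * l%:R ^+ l))).
    by rewrite ler_wpM2l // ler_wpM2r // exprnn_le_fact.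
  rewrite -mulrA mulrCA exprMn ler_wpM2l ?exprn_ge0 // mulrA.
  by apply: le_trans (bin_mul_exprnn_le R (l + k) l); rewrite ler_wpM2r.
have -> : N%:R = N%:R * (l%:R ^+ l * l%:R ^+ l) / (l%:R ^+ 2) ^+ l :> R.
  by rewrite expr2 exprMn mulfK // mulf_neq0 // expf_neq0 // gt_eqF.
apply: le_trans (ler_wpM2r _ count) _; first by rewrite invr_ge0 !exprn_ge0.
rewrite -expr_div_n lerXn2r ?nnegrE ?divr_ge0 ?mulr_ge0 ?exprn_ge0 //; try lra.
rewrite [(3 * _)^-1]invfM [leRHS]mulrA ler_wpM2r ?invr_ge0 ?exprn_ge0 //.
rewrite natrD ler_pdivlMr //.
have -> : expR 1 * (expR 1 * (l%:R + k%:R)) * 3 = (l%:R + k%:R) * (3 * expR 1) * expR 1 :> R by ring.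
apply: (@le_trans _ _ (2 * k%:R * c * expR 1)); last by rewrite le_eqVlt; apply/orP; left; apply/eqP; ring.
rewrite ler_wpM2r // ler_pM //; lra.
Qed.

(* The exponentially small factor (13/14)^(l - j) saved by the containers beats
   the cost of the fingerprints, as soon as q = l / j is large. *)
Lemma container_count_bound (R : realType) (c0 c : R) (N k l j a q : nat) :
  0 < c0 -> c0 <= c -> (13 <= q)%N ->
  48 * expR 1 / c0 * q%:R ^+ 2 * (13 / 14) ^+ q.-1 <= 1 ->
  (0 < j)%N -> (j <= k)%N -> (q * j <= l)%N -> (l <= 2 * q * j)%N ->
  7 * a%:R * l%:R <= 4 * c * k%:R ->
  (N * j`! <= 'C(j + k, j) * (4 ^ j * 'C(a, l - j)))%N ->
  N%:R <= (2 * c * expR 1 * k%:R / (3 * l%:R ^+ 2)) ^+ l.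
Proof.
move=> c00 c0c q13 Kq j0 jk qjl l2qj al; rewrite -(ler_nat R) !natrM natrX => count.
set X := 2 * c * expR 1 * k%:R / (3 * l%:R ^+ 2).
set K := 48 * expR 1 / c0 in Kq *.
set e : R := expR 1; have e0 : 0 < e by apply: expR_gt0.
have c'0 : 0 < c by apply: lt_le_trans c00 c0c.
have jl : (13 * j <= l)%N by apply: leq_trans qjl; rewrite leq_mul2r q13 orbT.
set r := (l - j)%N; have jr : l = (j + r)%N by rewrite /r; move: jl; clear; lia.
have r0 : (0 < r)%N by rewrite /r; move: j0 jl; clear; lia.
have j0' : 0 < j%:R :> R by rewrite ltr0n.
have r0' : 0 < r%:R :> R by rewrite ltr0n.
have l0' : 0 < l%:R :> R by rewrite ltr0n (leq_trans _ jl) // muln_gt0.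
have k0' : 0 < k%:R :> R by rewrite ltr0n (leq_trans j0).
have X0 : 0 < X by rewrite /X divr_gt0 // !mulr_gt0 // ?exprn_gt0 //.
have K0 : 0 < K by rewrite /K divr_gt0 // mulr_gt0.
(* Both [j!] and ['C(j + k, j)] contribute a factor [(e / j)^j]. *)
have raw : N%:R <= (4 * e ^+ 2 * (j + k)%:R / j%:R ^+ 2) ^+ j * (e * a%:R / r%:R) ^+ r.
  have jj : 0 < (j%:R ^+ 2) ^+ j :> R by rewrite !exprn_gt0.
  have rr : 0 < r%:R ^+ r :> R by rewrite !exprn_gt0.
  rewrite !expr_div_n mulf_div ler_pdivlMr ?mulr_gt0 //.
  have h1 := bin_mul_exprnn_le R (j + k) j.
  have h2 := bin_mul_exprnn_le R a r.
  have h3 := exprnn_le_fact R j.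
  rewrite -/e -/r in count h1 h2 h3.
  apply: (@le_trans _ _ (N%:R * (e ^+ j * j`!%:R * j%:R ^+ j * r%:R ^+ r))).
    by rewrite ler_wpM2l // ler_wpM2r ?(ltW rr) // exprAC expr2 ler_wpM2r // exprn_ge0.
  have -> : N%:R * (e ^+ j * j`!%:R * j%:R ^+ j * r%:R ^+ r) =
     e ^+ j * ((N%:R * j`!%:R) * (j%:R ^+ j * r%:R ^+ r)) by ring.
  have -> : (4 * e ^+ 2 * (j + k)%:R) ^+ j * (e * a%:R) ^+ r =
    e ^+ j * ((e * (j + k)%:R) ^+ j * (4 ^+ j * (e * a%:R) ^+ r)).
    by rewrite !exprMn; ring.
  rewrite ler_wpM2l ?exprn_ge0 ?(ltW e0) //.
  apply: (@le_trans _ _ ('C(j + k, j)%:R * j%:R ^+ j * (4 ^+ j * ('C(a, r)%:R * r%:R ^+ r)))).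
    apply: (@le_trans _ _ ('C(j + k, j)%:R * (4 ^+ j * 'C(a, r)%:R) * (j%:R ^+ j * r%:R ^+ r))).
      by rewrite ler_wpM2r // mulr_ge0 // exprn_ge0.
    by rewrite le_eqVlt; apply/orP; left; apply/eqP; ring.
  rewrite ler_pM ?mulr_ge0 ?exprn_ge0 //.
  by rewrite ler_wpM2l ?exprn_ge0.
apply: le_trans raw _.
(* The 48 in [K] absorbs the losses in [j + k <= 2k] and [l <= 2qj]; [c0 <= c] removes the
   dependence on [c]. *)
have fingerprint : 4 * e ^+ 2 * (j + k)%:R / j%:R ^+ 2 <= X * (K * q%:R ^+ 2).
  have jk' : (j + k)%:R <= 2 * k%:R :> R by rewrite -natrM ler_nat mul2n -addnn leq_add2r.
  have lqj : l%:R ^+ 2 <= (2 * q%:R * j%:R) ^+ 2 :> R.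
    by rewrite lerXn2r ?nnegrE ?mulr_ge0 // -!natrM ler_nat.
  rewrite ler_pdivrMr ?exprn_gt0 //.
  have -> : X * (K * q%:R ^+ 2) * j%:R ^+ 2 =
     8 * e ^+ 2 * k%:R * (c / c0 * ((2 * q%:R * j%:R) ^+ 2 / l%:R ^+ 2)).
    by rewrite /X /K -/e; field; rewrite !gt_eqF.
  apply: (@le_trans _ _ (8 * e ^+ 2 * k%:R)).
    have -> : 8 * e ^+ 2 * k%:R = 4 * e ^+ 2 * (2 * k%:R) by ring.
    by rewrite ler_wpM2l // mulr_ge0 // exprn_ge0 // ltW.
  rewrite ler_peMr ?mulr_ge0 ?exprn_ge0 ?(ltW e0) //.
  rewrite mulr_ege1 // ler_pdivlMr ?mul1r // exprn_gt0 //.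
(* Here 13/14 is 4/7 over 2/3, times the loss 13/12 from [r >= 12 l / 13]. *)
have rest : e * a%:R / r%:R <= X * (13 / 14).
  have lr : 12 * l%:R <= 13 * r%:R :> R by rewrite -!natrM ler_nat /r; move: jl; clear; lia.
  rewrite ler_pdivrMr // -(ler_pM2r (_ : 0 < 7 * l%:R)) ?mulr_gt0 //.
  apply: (@le_trans _ _ (e * (4 * c * k%:R))).
    by apply: le_trans (ler_wpM2l (ltW e0) al); rewrite le_eqVlt; apply/orP; left; apply/eqP; ring.
  have -> : X * (13 / 14) * r%:R * (7 * l%:R) = e * (4 * c * k%:R) * (13 * r%:R / (12 * l%:R)).
    by rewrite /X -/e; field; rewrite !gt_eqF.
  rewrite ler_peMr ?mulr_ge0 ?(ltW e0) ?(ltW c'0) //.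
  by rewrite ler_pdivlMr ?mul1r // mulr_gt0.
have KqX : 0 <= K * q%:R ^+ 2 by rewrite mulr_ge0 ?exprn_ge0 // ltW.
apply: (@le_trans _ _ ((X * (K * q%:R ^+ 2)) ^+ j * (X * (13 / 14)) ^+ r)).
  have b0 : 0 <= 4 * e ^+ 2 * (j + k)%:R / j%:R ^+ 2.
    by rewrite divr_ge0 ?mulr_ge0 ?exprn_ge0 // ltW.
  have a0 : 0 <= e * a%:R / r%:R by rewrite divr_ge0 ?mulr_ge0 // ltW.
  have [b1 a1] := (le_trans b0 fingerprint, le_trans a0 rest).
  by rewrite ler_pM ?exprn_ge0 // lerXn2r ?nnegrE.
have -> : (X * (K * q%:R ^+ 2)) ^+ j * (X * (13 / 14)) ^+ r =
    X ^+ l * ((K * q%:R ^+ 2) ^+ j * (13 / 14) ^+ r).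
  by rewrite jr exprD [(X * (K * _)) ^+ j]exprMn [(X * (13 / 14)) ^+ r]exprMn mulrACA.
rewrite ler_piMr ?exprn_ge0 ?(ltW X0) //.
(* As [q j <= l], at least [(q - 1) j] factors 13/14 are available, [q - 1] for each fingerprint
   element. *)
have le1 : (13 / 14) ^+ r <= ((13 / 14) ^+ q.-1) ^+ j :> R.
  rewrite -exprM; apply: ler_wiXn2l; try lra.
  have qj : (q.-1 * j + j <= l)%N by rewrite -mulSnr prednK // (leq_trans _ q13).
  by rewrite leq_subRL ?(leq_trans _ qj) ?leq_addl // addnC.
apply: (@le_trans _ _ ((K * q%:R ^+ 2) ^+ j * ((13 / 14) ^+ q.-1) ^+ j)).
  by rewrite ler_wpM2l // exprn_ge0.
rewrite -exprMn exprn_ile1 // mulr_ge0 // exprn_ge0 //; lra.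
Qed.

(** * Choice of constants and conclusion *)

Theorem theorem1p3 (R : realType) (c0 delta : R) :
  0 < c0 -> 0 < delta ->
  exists C : R, 0 < C /\
    forall (k l : nat) (c : R),
      (0 < k)%N -> (0 < l)%N ->
      C * k%:R <= (l ^ 3)%N%:R ->
      c0 <= c ->
      (#|good_sets k l c|)%:R <=
        (2 : R) `^ (delta * l%:R) *
        (2 * c * expR 1 * k%:R / (3 * l%:R ^+ 2)) ^+ l.
Proof.
move=> c00 delta0; have e0 : 0 < expR 1 :> R by apply: expR_gt0.
have [q q13 Kq] : exists2 q, (13 <= q)%N &
    48 * expR 1 / c0 * q%:R ^+ 2 * (13 / 14) ^+ q.-1 <= 1 :> R.
  by apply: square_mul_geometric_small; rewrite divr_gt0 ?mulr_gt0.
(* The first summand yields [m <= D * D] when [c < 3e]; the second yields [17 q <= l], hence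
   [0 < D]. *)
pose C : R := 3 * expR 1 * (34 * q%:R) ^+ 2 + (17 * q%:R) ^+ 2.
have q0 : 0 < q%:R :> R by rewrite ltr0n (leq_trans _ q13).
exists C; split; first by rewrite /C addr_gt0 ?mulr_gt0 ?exprn_gt0 ?mulr_gt0.
move=> k l c k0 l0 Ckl c0c.
have c'0 : 0 < c by apply: lt_le_trans c00 c0c.
have X0 : 0 <= 2 * c * expR 1 * k%:R / (3 * l%:R ^+ 2).
  by rewrite divr_ge0 ?mulr_ge0 ?exprn_ge0 // ltW.
suff bound : (#|good_sets k l c|)%:R <= (2 * c * expR 1 * k%:R / (3 * l%:R ^+ 2)) ^+ l.
  apply: le_trans bound _; rewrite ler_peMl ?exprn_ge0 //.
  rewrite -[leLHS](powRr0 2) ler_powR ?ler1n // mulr_ge0 // ltW //.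
(* A member [S0] yields [l <= k]: its [l] elements are positive and sum to [k]. *)
have [->|[S0]] := set_0Vmem (good_sets k l c); first by rewrite cards0 exprn_ge0.
rewrite inE => /and4P [S00 /eqP S0l /eqP S0k _].
have lk : (l <= k)%N.
  rewrite -S0k -S0l -sum1_card; apply: leq_sum => a aS.
  by rewrite lt0n; apply: contraNneq S00 => a0; rewrite (_ : ord0 = a) //; apply: val_inj.
have l0' : 0 < l%:R :> R by rewrite ltr0n.
(* Since [C] may not depend on [c], large [c] is settled by the trivial count. *)
have [ec|ce] := leP (3 * expR 1) c.
  apply: trivial_count_bound => //; apply: leq_trans (card_sets_of_small_sum k l).
  rewrite leq_mul2r subset_leq_card ?orbT //; apply/fintype.subsetP => S.
  by rewrite !inE => /and4P [_ -> /eqP -> _]; rewrite leqnn.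
(* The fingerprint size [17 * D] is about [l / q]; rounding down costs at most a factor 2, because
   [D] is positive. *)
pose D := (l %/ (17 * q))%N; pose m := Num.truncn (c * k%:R / l%:R).
have m_le : m%:R <= c * k%:R / l%:R :> R.
  by rewrite truncn_le divr_ge0 ?mulr_ge0 // ltW.
have ql : (17 * q <= l)%N.
  have : (17 * q%:R) ^+ 2 * l%:R <= l%:R ^+ 2 * l%:R :> R.
    rewrite -exprSr -natrX; apply: le_trans Ckl.
    apply: (@le_trans _ _ (C * l%:R)).
      by rewrite ler_wpM2r // /C lerDr mulr_ge0 ?exprn_ge0 ?mulr_ge0 ?(ltW e0).
    by rewrite ler_wpM2l ?ler_nat // /C addr_ge0 ?mulr_ge0 ?exprn_ge0 ?mulr_ge0 ?(ltW e0).
  by rewrite ler_pM2r // -natrM -!natrX ler_nat leq_exp2r.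
have q0' : (0 < 17 * q)%N by rewrite muln_gt0 (leq_trans _ q13).
have D0 : (0 < D)%N by rewrite divn_gt0.
have Dl : (q * (17 * D) <= l)%N by rewrite mulnA [(q * 17)%N]mulnC mulnC leq_divM.
have lD : (l <= 2 * q * (17 * D))%N.
  have := ltn_ceil l q0'; rewrite -/D; move: D0; clear; nia.
have mD : (m <= D * D)%N.
  rewrite -(ler_nat R) natrM; apply: le_trans m_le _.
  have lD' : l%:R <= 34 * q%:R * D%:R :> R.
    rewrite -!natrM ler_nat (leq_trans lD) //; move: q0'; clear; lia.
  rewrite ler_pdivrMr // -(ler_pM2l (_ : 0 < (34 * q%:R) ^+ 2)) ?exprn_gt0 ?mulr_gt0 //.
  apply: (@le_trans _ _ (l%:R ^+ 3)).
    rewrite -natrX; apply: le_trans Ckl.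
    rewrite mulrA ler_wpM2r // /C (le_trans (ler_wpM2l _ (ltW ce))) ?exprn_ge0 ?mulr_ge0 //.
    by rewrite [leLHS]mulrC lerDl exprn_ge0 // mulr_ge0.
  have -> : (34 * q%:R) ^+ 2 * (D%:R * D%:R * l%:R) = (34 * q%:R * D%:R) ^+ 2 * l%:R :> R.
    by ring.
  by rewrite (exprSr _ 2) ler_wpM2r // lerXn2r ?nnegrE ?mulr_ge0.
have D17l : (17 * D <= l)%N.
  by apply: leq_trans Dl; rewrite leq_pmull // (leq_trans _ q13).
apply: (@container_count_bound R c0 c _ k l (17 * D) (4 * m %/ 7) q) => //.
- by rewrite muln_gt0.
- exact: leq_trans lk.
- apply: (@le_trans _ _ (4 * m%:R * l%:R)).
    rewrite ler_wpM2r // -!natrM ler_nat mulnC; exact: leq_divM.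
  by rewrite -!mulrA ler_wpM2l // -ler_pdivlMr.
apply: leq_trans (card_sets_of_small_sumset k l m D D0 D17l mD).
rewrite leq_mul2r subset_leq_card ?orbT //; apply/fintype.subsetP => S.
rewrite !inE => /and4P [_ -> /eqP -> Sm]; rewrite leqnn /=.
by rewrite /m truncn_ge_nat ?divr_ge0 ?mulr_ge0 ?(ltW c'0) // -sumset_cardE.
Qed.
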